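(* Let $C = 1.25506$ and, for real $n > 1$, let $$E(n) := \frac{n}{\log n}\left(\log 4 - C - \frac{\log 2 \,\log 4}{\log(2n)}\right).$$ Suppose there exist integers $n^\star > 1$ and $r \geq 0$ such that $E(n^\star) > r+1$. Then for all integers $m, n$ with $m \geq n \geq n^\star$, the integer $P(m,n) := \prod_{i=1}^{n}(m+i)$ is divisible by more than $r$ distinct primes, all strictly greater than $n$. That is, the product of $n$ consecutive integers all strictly greater than $n$ is divisible by more than $r$ distinct primes strictly greater than $n$.
   Context: $\log$ denotes the natural logarithm. *)

(* Defs.v *)
From mathcomp Require Import all_boot all_order all_algebra.
From mathcomp Require Import all_reals exp.

Set Implicit Arguments.
Unset Strict Implicit.
Unset Printing Implicit Defensive.

Import GRing.Theory Num.Theory.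

Local Open Scope ring_scope.

(* 1.25506; split into small numerals because ring literals are unary. *)
Definition constC (R : realType) : R := 1 + 255 / 10 ^+ 3 + 6 / 10 ^+ 5.

(* Meaningful for x > 1; elsewhere [ln] and division take junk values. *)
Definition E (R : realType) (x : R) : R :=
  x / ln x * (ln 4 - constC R - ln 2 * ln 4 / ln (2 * x)).

Definition prodP (m n : nat) : nat := (\prod_(1 <= i < n.+1) (m + i))%N.

(* [primes N] lists each prime divisor of [N > 0] exactly once. *)
Definition nb_primes_gt (n N : nat) : nat :=
  count (fun p => n < p)%N (primes N).

(* Main.v *)
Require Import Defs.
From mathcomp Require Import all_boot all_order all_algebra.
From mathcomp Require Import all_reals exp.
From Stdlib Require BinNat.
From mathcomp Require Import zify ring lra.

(** Proof idea.  Erdos' treatment of the Sylvester-Schur theorem is used, which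
    avoids any sharp bound on the prime counting function.  Put [N = m + n].
    Every prime power in [C(N, n)] is at most [N], a prime [p] with [p ^ 2 > N]
    occurs at most once, and an odd prime [p <= n] with [N < 3 p] does not occur
    if [m >= n].  Hence, with [k] the number of primes [> n] dividing the product,
    [C(N, n) <= 4 ^ x * N ^ (pi (sqrt N) + k)], where [x = N / 3] if [N <= 3 n]
    and [x = n] otherwise, whereas [C(N, n)] is bounded below by
    [4 ^ n (3 / 2) ^ (N - 2 n) / (2 n)] for [N <= 3 n], by [6 ^ n / (2 n)] for
    [N > 3 n], by [8 ^ n / (2 n)] for [N > 4 n], and by [(N / n) ^ n] always.
    When [N ^ 5 > n ^ 8], [C(N, n) <= N ^ (pi n + k)] is used instead.
    The condition [E nstar > r + 1] only enters through its consequences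
    [nstar >= 900] and [(r + 1) ln n <= 27 n / 200] for all [n >= nstar];
    [pi x <= (x + 5) / 3] is enough for the prime counting function. *)

Set Implicit Arguments.
Unset Strict Implicit.
Unset Printing Implicit Defensive.

Import Order.TTheory GRing.Theory Num.Theory.

(** * Prime factors of binomial coefficients *)

Definition prime_pi (n : nat) : nat := count prime (iota 0 n.+1).

Definition primorial (n : nat) : nat := \prod_(p <- iota 0 n.+1 | prime p) p.

(** A prime above 3 is 1 or 5 modulo 6, so six consecutive integers above 3 contain at most two
    primes; hence induction in steps of six. *)
Lemma prime_pi_bound n : 3 * prime_pi n <= n + 5.
Proof.
elim/ltn_ind: n => n IH.
(* The cut-off 9 gives [n - 6 >= 3], so the window above [n - 6] avoids 2 and 3. *)
have [n_small|n_large] := ltnP n 9.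
  by move: n_small {IH}; do 9! [case: n => [|n] //].
have /IH {}IH : n - 6 < n by lia.
have nE : n = (n - 6) + 6 by lia.
have s_ge : 3 <= n - 6 by lia.
rewrite nE; move: (n - 6) IH s_ge => s IH s_ge.
suff : prime_pi (s + 6) <= prime_pi s + 2 by lia.
have -> : prime_pi (s + 6) = prime_pi s + count prime (iota s.+1 6).
  by rewrite /prime_pi -addSn iotaD count_cat.
rewrite leq_add2l.
have prime6 p : 3 < p -> prime p -> (p %% 6 == 1) || (p %% 6 == 5).
  move=> p_gt3 /primeP[_ pdvd].
  have p2 : ~~ (2 %| p) by apply/negP => /pdvd; lia.
  have p3 : ~~ (3 %| p) by apply/negP => /pdvd; lia.
  lia.
pose cop6 p := (p %% 6 == 1) || (p %% 6 == 5).
(* Sliding the window by one trades [t] for [t + 6], which has the same residue. *)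
have count_cop6 t : count cop6 (iota t 6) = 2.
  elim: t => [//|t IHt].
  have := etrans (esym (iotaD t 1 6)) (iotaD t 6 1 : iota t (1 + 6) = _).
  move/(congr1 (count cop6)); rewrite !count_cat IHt addn1.
  rewrite [count _ (iota t 1)]/= [count _ (iota (t + 6) 1)]/= !addn0.
  rewrite [cop6 (t + 6)]/cop6 modnDr.
  by rewrite addnC => /addIn.
apply: (@leq_trans (count cop6 (iota s.+1 6))); last by rewrite count_cop6.
rewrite -!size_filter.
apply: uniq_leq_size; first by rewrite filter_uniq ?iota_uniq.
move=> p; rewrite !mem_filter => /andP[pp p_in]; rewrite p_in andbT.
move: p_in; rewrite mem_iota => /andP[sp _].
by apply: prime6 => //; apply: leq_ltn_trans sp.
Qed.

Lemma prime_dvd_fact p n : prime p -> p %| n`! -> p <= n.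
Proof.
move=> pp; elim: n => [|n IH].
  by rewrite dvdn1 => /eqP p1; rewrite p1 in pp.
rewrite factS Euclid_dvdM // => /orP[/dvdn_leq-> //|/IH]; exact: leqW.
Qed.

Lemma prod_primes_dvd (l : seq nat) d :
  uniq l -> {in l, forall p, prime p && (p %| d)} -> \prod_(p <- l) p %| d.
Proof.
elim: l => [|p l IH] /=; first by rewrite big_nil dvd1n.
case/andP=> pl ul H; have /andP[pp pd] := H p (mem_head _ _).
rewrite big_cons Gauss_dvd; last first.
  rewrite coprime_sym big_seq; apply: (big_ind (fun x => coprime x p)).
  - exact: coprime1n.
  - by move=> x y hx hy; rewrite coprimeMl hx hy.
  move=> q ql; have /andP[qp _] : prime q && (q %| d).
    by apply: H; rewrite inE ql orbT.
  rewrite prime_coprime // dvdn_prime2 //.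
  by apply: contraNneq pl => <-.
by rewrite pd IH // => q ql; apply: H; rewrite inE ql orbT.
Qed.

(** [C(2m+1, m)] and [C(2m+1, m+1)] are equal and are two distinct terms of the row sum
    [2 ^ (2m+1)]. *)
Lemma bin_mid_le m : 'C(m.*2.+1, m) <= 4 ^ m.
Proof.
rewrite -(leq_pmul2l (isT : 0 < 2)) -[4]/(2 ^ 2) -expnM mul2n -expnS.
have -> : 2 ^ (2 * m).+1 = \sum_(i < m.*2.+2) 'C(m.*2.+1, i).
  rewrite mul2n -[2]/(1 + 1) expnDn; apply: eq_bigr => i _.
  by rewrite !exp1n !muln1.
have lt1 : m < m.*2.+2 by lia.
have lt2 : m.+1 < m.*2.+2 by lia.
rewrite (bigD1 (Ordinal lt1)) // (bigD1 (Ordinal lt2)) /=; last first.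
  by rewrite -val_eqE /= neq_ltn ltnSn orbT.
rewrite addnA; apply: leq_trans (leq_addr _ _).
rewrite -addnn leq_add2l -bin_sub; last lia.
by rewrite (_ : m.*2.+1 - m = m.+1) //; lia.
Qed.

(** Strong induction: an even [n > 2] is not prime, and for [n = 2m+1] the primes from [m+2] to
    [2m+1] all divide [C(2m+1, m) <= 4 ^ m]. *)
Lemma primorial_le n : primorial n <= 4 ^ n.
Proof.
elim/ltn_ind: n => n IH.
have [n_small|n_gt2] := leqP n 2.
  by move: n_small {IH}; case: n => [|[|[|n]]] //; rewrite /primorial ?unlock.
have [m_odd|m_even] := boolP (odd n); last first.
  case: n n_gt2 m_even IH => // n n_gt2 n_odd IH.
  rewrite /primorial -[n.+2]addn1 iotaD big_cat /= add0n.
  rewrite [X in _ * X]big_mkcond big_seq1 /=.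
  have -> : prime n.+1 = false.
    apply/negP => /even_prime[|] h; first by lia.
    by rewrite h in n_odd.
  by rewrite muln1; apply: leq_trans (IH n (ltnSn n)) _; rewrite leq_exp2l.
have nE : n = n./2.*2.+1 by rewrite -[LHS]odd_double_half m_odd.
move: n_gt2 IH; rewrite nE; move: n./2 => m m_gt0 IH {n m_odd nE}.
have -> : primorial m.*2.+1 =
    primorial m.+1 * \prod_(p <- iota m.+2 m | prime p) p.
  by rewrite /primorial -big_cat -iotaD; congr (bigop _ _ _); congr iota; lia.
have -> : m.*2.+1 = m.+1 + m by lia.
rewrite expnD; apply: leq_mul; first by apply: IH; lia.
apply: leq_trans (bin_mid_le m).
apply: dvdn_leq; first by rewrite bin_gt0; lia.
rewrite -big_filter; apply: prod_primes_dvd => [|p].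
  by rewrite filter_uniq ?iota_uniq.
rewrite mem_filter mem_iota => /andP[pp /andP[mp pm]]; rewrite pp /=.
have : p %| m.*2.+1`! by apply: dvdn_fact; rewrite prime_gt0 //=; lia.
rewrite -(@bin_fact m.*2.+1 m); last lia.
rewrite !Euclid_dvdM // => /orP[//|/orP[] /(prime_dvd_fact pp)]; lia.
Qed.

(** Legendre's formula for three factorials, all summed up to [m + n] since the extra terms vanish.
    The truncated subtraction is exact because floors are superadditive. *)
Lemma logn_bin_sum p m n : prime p ->
  logn p 'C(m + n, n) =
  \sum_(1 <= k < (m + n).+1) ((m + n) %/ p ^ k - (m %/ p ^ k + n %/ p ^ k)).
Proof.
move=> pp.
have ext q : q <= m + n ->
    logn p q`! = \sum_(1 <= k < (m + n).+1) q %/ p ^ k.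
  move=> qN; rewrite logn_fact // [RHS](@big_cat_nat _ _ _ q.+1) //=.
  rewrite [X in _ = _ + X]big_nat [X in _ = _ + X]big1 ?addn0 // => k.
  case/andP=> qk _.
  by rewrite divn_small // (leq_trans qk) // ltnW // ltn_expl // prime_gt1.
have := congr1 (logn p) (bin_fact (leq_addl m n)).
rewrite addnK !lognM ?muln_gt0 ?fact_gt0 ?bin_gt0 ?leq_addl //.
rewrite !ext ?leq_addl ?leq_addr // => h.
rewrite sumnB => [|k _]; last by rewrite divnD ?leq_addr // expn_gt0 prime_gt0.
by rewrite big_split /= -h [X in _ - X]addnC addnK.
Qed.

(** Each term of Legendre's sum is at most 1 and vanishes once [p ^ k > m + n], so the exponent is
    at most [trunc_log p (m + n)]. *)
Lemma expn_logn_bin p m n : prime p -> 0 < m + n ->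
  p ^ logn p 'C(m + n, n) <= m + n.
Proof.
move=> pp N0; have p1 := prime_gt1 pp.
apply: leq_trans (trunc_logP p1 N0).
rewrite leq_exp2l // logn_bin_sum //.
set t := trunc_log p (m + n).
have tN : t <= m + n.
  exact: leq_trans (ltnW (ltn_expl _ p1)) (trunc_logP p1 N0).
rewrite (@big_cat_nat _ _ _ t.+1) //=.
rewrite [X in _ + X <= _]big_nat [X in _ + X <= _]big1 => [|k /andP[tk _]].
  rewrite addn0; apply: (@leq_trans (\sum_(1 <= k < t.+1) 1)).
    by apply: leq_sum => k _; rewrite leq_subLR leq_divDl.
  by rewrite sum_nat_const_nat muln1 subn1.
have lt : m + n < p ^ k.
  by rewrite (leq_trans (trunc_log_ltn _ p1)) // leq_exp2l.
by rewrite divn_small.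
Qed.

(* Such a prime contributes nothing to Legendre's sum:
   [floor(N/p) = 2] while [floor(m/p) = floor(n/p) = 1]. *)
Lemma prime_third_ndvd_bin p m n : prime p -> 2 < p -> n <= m ->
  p <= n -> m + n < 3 * p -> ~~ (p %| 'C(m + n, n)).
Proof.
move=> pp p_gt2 nm pn Np; apply/negP => pC.
have : 0 < logn p 'C(m + n, n).
  by rewrite logn_gt0 mem_primes pp pC bin_gt0 leq_addl.
rewrite logn_bin_sum // big_nat big1 // => -[//|[|k]] _.
  rewrite expn1.
  have p0 := prime_gt0 pp.
  have m_p : 0 < m %/ p by rewrite divn_gt0 // (leq_trans pn).
  have n_p : 0 < n %/ p by rewrite divn_gt0.
  have N_p : (m + n) %/ p < 3 by rewrite ltn_divLR.
  lia.
(* For the square and higher powers, [p > 2] makes the power at least [3 p > m + n]. *)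
rewrite [(m + n) %/ _]divn_small //.
apply: (leq_trans Np); rewrite !expnS mulnA.
apply: (@leq_trans (p * p)); first by rewrite leq_mul2r p_gt2 orbT.
by rewrite leq_pmulr // expn_gt0 prime_gt0.
Qed.

Lemma prodPE m n : prodP m n = 'C(m + n, n) * n`!.
Proof.
have /(congr1 (fun x => x %/ m`!)) : prodP m n * m`! = 'C(m + n, n) * n`! * m`!.
  have := bin_fact (leq_addl m n); rewrite addnK mulnA => ->.
  elim: n => [|n IH]; first by rewrite /prodP big_geq // mul1n addn0.
  by rewrite /prodP big_nat_recr //= mulnAC IH addnS factS mulnC.
by rewrite !mulnK ?fact_gt0.
Qed.

(** Primes up to [s] and primes above [n] are charged [m + n] each, a bound for their power in the
    coefficient; primes in between occur at most once and multiply to at most [primorial x]. *)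
Lemma bin_upper m n s x : n <= m -> 0 < n ->
  (forall p, prime p -> p %| 'C(m + n, n) -> s < p -> p <= n ->
     (p <= x) && (m + n < p ^ 2)) ->
  'C(m + n, n) <=
    primorial x * (m + n) ^ (prime_pi s + nb_primes_gt n (prodP m n)).
Proof.
move=> nm n0 H; set C := 'C(m + n, n); set N := m + n.
have C0 : 0 < C by rewrite bin_gt0 leq_addl.
have N0 : 0 < N by rewrite addn_gt0 n0 orbT.
rewrite [leqLHS]prod_prime_decomp // prime_decompE big_map /=.
apply: (@leq_trans (\prod_(p <- primes C)
   ((if (s < p) && (p <= n) then p else 1) *
    ((if p <= s then N else 1) * (if n < p then N else 1))))).
  rewrite big_seq [leqRHS]big_seq; apply: leq_prod => p.
  rewrite mem_primes => /and3P[pp _ pC].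
  have vN := expn_logn_bin pp N0.
  have [ps|ps] := leqP p s; have [np|np] := leqP p n;
    rewrite /= ?mul1n ?muln1 //.
    (* A prime with [n < p <= s] is charged twice, which only weakens the bound. *)
    by rewrite (leq_trans vN) // leq_pmulr.
  have /andP[_ Np] := H p pp pC ps np.
  rewrite -[leqRHS]expn1 leq_exp2l ?prime_gt1 // leqNgt; apply/negP => v2.
  move: Np; rewrite ltnNge => /negP; apply; apply: leq_trans vN.
  by rewrite leq_exp2l // prime_gt1.
rewrite !big_split /= -!big_mkcond /= !big_const_seq !iter_muln_1 expnD.
apply: leq_mul; last apply: leq_mul.
- rewrite -big_filter.
  have sub : {subset [seq p <- primes C | (s < p) && (p <= n)] <=
              [seq p <- iota 0 x.+1 | prime p]}.
    move=> p; rewrite !mem_filter mem_primes mem_iota.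
    case/andP=> /andP[sp pn] /and3P[pp _ pC].
    by have /andP[px _] := H p pp pC sp pn; rewrite pp.
  rewrite /primorial -[leqRHS]big_filter; apply: dvdn_leq.
    rewrite big_filter; apply: prodn_cond_gt0 => p; exact: prime_gt0.
  apply: prod_primes_dvd; first by rewrite filter_uniq ?primes_uniq.
  move=> p /sub pl; have := pl; rewrite mem_filter => /andP[-> _] /=.
  by rewrite (bigD1_seq p pl) ?filter_uniq ?iota_uniq //= dvdn_mulr.
- apply: leq_pexp2l => //; rewrite /prime_pi -!size_filter.
  apply: uniq_leq_size; first by rewrite filter_uniq ?primes_uniq.
  move=> p; rewrite !mem_filter mem_primes mem_iota add0n ltnS.
  by case/and3P=> -> ->.
apply: leq_pexp2l => //; rewrite /nb_primes_gt -!size_filter.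
apply: uniq_leq_size; first by rewrite filter_uniq ?primes_uniq.
move=> p; rewrite !mem_filter !mem_primes => /and4P[-> -> _ pC].
by rewrite prodPE muln_gt0 C0 fact_gt0 /= dvdn_mulr.
Qed.

(** * Lower bounds for binomial coefficients *)

Lemma expn_le_binM m n : 0 < n -> (m + n) ^ n <= n ^ n * 'C(m + n, n).
Proof.
move=> n0; rewrite -(leq_pmul2r (fact_gt0 n)) -mulnA bin_ffact ffact_prod.
(* The coefficient is the product of [(m + n - i) / (n - i)], each factor being at least
   [(m + n) / n]. *)
have -> : n`! = \prod_(i < n) (n - i) by rewrite -ffact_prod ffactnn.
have pow a : a ^ n = \prod_(i < n) a by rewrite prod_nat_const card_ord.
rewrite (pow (m + n)) (pow n) -!big_split /=.
by apply: leq_prod => i _; have := ltn_ord i; nia.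
Qed.

(** Induction from [(n+1) C(2n+2, n+1) = 2 (2n+1) C(2n, n)], assembled from [e1] and [e2]. *)
Lemma central_bin_ge n : 0 < n -> 4 ^ n <= 2 * n * 'C(n + n, n).
Proof.
case: n => // n _; elim: n => [//|n IH].
have e1 := mul_bin_diag (n.+2 + n.+2) n.+1.
have e2 := mul_bin_down (n.+1 + n.+2) n.+1.
rewrite addSn /= in e1; rewrite addnS /= in e2.
have -> : n.+2 + n.+2 = (n.+1 + n.+2).+1 by lia.
rewrite addnS in e1 *; rewrite expnS.
apply: (@leq_trans (4 * (2 * n.+1 * 'C(n.+1 + n.+1, n.+1)))).
  by rewrite leq_mul2l IH.
have {}e2 : n.+2 * 'C((n.+1 + n.+1).+1, n.+1) =
    (n.+1 + n.+1).+1 * 'C(n.+1 + n.+1, n.+1).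
  by rewrite e2; congr (_ * _); lia.
nia.
Qed.

(* C(N+1,n)/C(N,n) = (N+1)/(N+1-n) >= (k+1)/k as long as N < (k+1) n *)
Lemma bin_step_ge k n j : 0 < k -> k * n + j <= k.+1 * n ->
  k.+1 ^ j * 'C(k * n, n) <= k ^ j * 'C(k * n + j, n).
Proof.
move=> k0; elim: j => [|j IH] h; first by rewrite !mul1n addn0.
have {}IH := IH ltac:(lia).
have e := mul_bin_down (k * n + j).+1 n; rewrite /= in e.
rewrite addnS !expnS -!mulnA.
apply: (@leq_trans (k.+1 * (k ^ j * 'C(k * n + j, n)))).
  by rewrite leq_mul2l IH.
rewrite mulnCA [leqRHS]mulnCA leq_mul2l; apply/orP; right.
have d0 : 0 < (k * n + j).+1 - n by rewrite subn_gt0 ltnS; nia.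
rewrite -(leq_pmul2l d0) [leqRHS]mulnCA -e mulnCA [leqRHS]mulnA mulnA leq_mul2r.
apply/orP; right; nia.
Qed.

Local Open Scope ring_scope.

(** * Logarithms of natural numbers *)

Lemma ler_ln_nat (R : realType) (a b : nat) : (0 < a)%N -> (a <= b)%N ->
  ln a%:R <= ln b%:R :> R.
Proof.
by move=> a0 ab; rewrite ler_ln ?posrE ?ltr0n ?ler_nat // (leq_trans a0).
Qed.

Lemma ln_natM (R : realType) (a b : nat) : (0 < a)%N -> (0 < b)%N ->
  ln (a * b)%:R = ln a%:R + ln b%:R :> R.
Proof. by move=> a0 b0; rewrite natrM lnM ?posrE ?ltr0n. Qed.

Lemma ln_natX (R : realType) (a k : nat) : (0 < a)%N ->
  ln (a ^ k)%:R = k%:R * ln a%:R :> R.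
Proof. by move=> a0; rewrite natrX lnXn ?ltr0n // mulr_natl. Qed.

Lemma ln_succ_le (R : realType) (d : nat) : (0 < d)%N ->
  ln d.+1%:R - ln d%:R <= d%:R^-1 :> R.
Proof.
move=> d0; have dp : 0 < d%:R :> R by rewrite ltr0n.
rewrite -ln_div ?posrE ?ltr0n // -natr1 mulrDl divff ?gt_eqF // mul1r.
by apply: le_ln1Dx; apply: (lt_trans (ltrN10 R)); rewrite invr_gt0.
Qed.

Lemma ln_succ_ge (R : realType) (d : nat) : (0 < d)%N ->
  d.+1%:R^-1 <= ln d.+1%:R - ln d%:R :> R.
Proof.
move=> d0; have dp : 0 < d%:R :> R by rewrite ltr0n.
have Dp : 0 < d.+1%:R :> R by rewrite ltr0n.
rewrite -opprB lerNr -ln_div ?posrE //.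
have -> : d%:R / d.+1%:R = 1 + - d.+1%:R^-1 :> R.
  by rewrite -[in d%:R](addrK 1 d%:R) natr1 mulrBl divff ?gt_eqF // mul1r.
apply: le_ln1Dx; rewrite ltrN2 invf_lt1 // ltr1n.
by rewrite ltnS.
Qed.

(* The premise is stated in binary so that [vm_compute] decides it. *)
Lemma ln_mul_exp_le (R : realType) (a b c d j k : nat) :
  (0 < a)%N -> (0 < b)%N -> (0 < c)%N -> (0 < d)%N ->
  BinNat.N.leb
    (BinNat.N.mul (BinNat.N.of_nat a)
       (BinNat.N.pow (BinNat.N.of_nat b) (BinNat.N.of_nat j)))
    (BinNat.N.mul (BinNat.N.of_nat c)
       (BinNat.N.pow (BinNat.N.of_nat d) (BinNat.N.of_nat k))) ->
  ln a%:R + j%:R * ln b%:R <= ln c%:R + k%:R * ln d%:R :> R.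
Proof.
move=> a0 b0 c0 d0 /BinNat.N.leb_le h.
have bj0 : (0 < b ^ j)%N by rewrite expn_gt0 b0.
have dk0 : (0 < d ^ k)%N by rewrite expn_gt0 d0.
rewrite -!ln_natX // -!ln_natM //; apply: ler_ln_nat; last by lia.
by rewrite muln_gt0 a0.
Qed.

(** From [2 * 288 ^ 200 <= 289 ^ 200], as [200 / 288 = 25 / 36]; the lower bound below uses
    [116 ^ 80 <= 2 * 115 ^ 80] likewise. *)
Lemma ln2_ub (R : realType) : ln 2 <= 25 / 36 :> R.
Proof.
lapply (@ln_mul_exp_le R 2 288 1 289 200 200 isT isT isT isT);
  last by vm_compute.
have := @ln_succ_le R 288 isT.
rewrite ln1; lra.
Qed.

Lemma ln2_lb (R : realType) : 20 / 29 <= ln 2 :> R.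
Proof.
lapply (@ln_mul_exp_le R 1 116 2 115 80 80 isT isT isT isT);
  last by vm_compute.
have := @ln_succ_ge R 115 isT.
rewrite ln1; lra.
Qed.

Lemma ln3_lb (R : realType) : 19 / 12 * ln 2 <= ln 3 :> R.
Proof.
lapply (@ln_mul_exp_le R 1 2 1 3 19 12 isT isT isT isT);
  last by vm_compute.
rewrite ln1; lra.
Qed.

Lemma ln_lb_of_large (R : realType) n : (900 <= n)%N ->
  49 / 5 * ln 2 <= ln n%:R :> R.
Proof.
move=> n_ge; have := @ler_ln_nat R 900 n isT n_ge.
lapply (@ln_mul_exp_le R 1 2 1 900 49 5 isT isT isT isT);
  last by vm_compute.
rewrite ln1; lra.
Qed.

Lemma ln_ub_of_small (R : realType) n : (0 < n <= 900)%N ->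
  ln n%:R <= 59 / 6 * ln 2 :> R.
Proof.
case/andP=> n0 n_le; have := @ler_ln_nat R n 900 n0 n_le.
lapply (@ln_mul_exp_le R 1 900 1 2 6 59 isT isT isT isT);
  last by vm_compute.
rewrite ln1; lra.
Qed.

Lemma ln4 (R : realType) : ln 4 = 2 * ln 2 :> R.
Proof. exact: (@ln_natX R 2 2 isT). Qed.

Lemma ln_le_tangent (R : realType) (x a : R) : 0 < x -> 0 < a ->
  ln x <= ln a + x / a - 1.
Proof.
move=> x0 a0; have xa0 : 0 < x / a by rewrite divr_gt0.
have := @le_ln1Dx R (x / a - 1); rewrite [1 + _]addrC subrK ln_div ?posrE //.
by move=> /(_ ltac:(lra)); lra.
Qed.

(* [v], [l] stand for [n], [ln n]; the conclusion is [E n <= 1]. *)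
Lemma small_E_le1 (R : realFieldType) (L C v l : R) :
  20 / 29 <= L -> L <= 25 / 36 -> 251 / 200 <= C -> 0 < v -> v <= 9 * 10 ^+ 2 ->
  0 < l -> l <= 59 / 6 * L ->
  v * (2 * L - C - L * (2 * L) / (L + l)) <= l.
Proof.
move=> L_lb L_ub C_lb v0 v_ub l0 l_ub; have d0 : 0 < L + l by lra.
set F := _ - _ / _; rewrite leNgt; apply/negP => vF.
have F0 : 0 < F by rewrite -(pmulr_rgt0 _ v0) (lt_trans l0).
have qE : (2 * L - C - F) * (L + l) = L * (2 * L).
  by rewrite /F subKr divfK ?gt_eqF.
move: F F0 qE vF => F F0 qE vF.
have LL : 20 / 29 * (20 / 29) <= L * L by apply: ler_pM; lra.
(* [F > 0] means [(2 L - C) (L + l) > 2 L ^ 2], while [2 L - C < 27 / 200]. *)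
have l_lb : 63 / 10 <= l.
  have : 0 <= (27 / 200 - (2 * L - C)) * (L + l) by apply: mulr_ge0; lra.
  have := mulr_gt0 F0 d0; lra.
(* Since [L + l <= 65 L / 6], the subtracted quotient is at least [12 L / 65]. Then [F <= 6 / 1000],
   so [v F <= 5.4 < l]. *)
have F_ub : F <= 118 / 65 * L - C.
  have q0 : 0 <= 2 * L - C - F.
    by rewrite -(pmulr_lge0 _ d0) qE; apply: mulr_ge0; lra.
  have : 0 <= (2 * L - C - F) * (65 / 6 * L - (L + l)) by apply: mulr_ge0; lra.
  move=> h; have : L * (2 * L) <= L * (65 / 6 * (2 * L - C - F)) by lra.
  rewrite ler_pM2l; lra.
have : v * F <= 9 * 10 ^+ 2 * (6 / 10 ^+ 3) by apply: ler_pM; lra.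
lra.
Qed.

(** * Numerical comparisons *)

(* [L], [v], [l], [y], [lN] stand for [ln 2], [n], [ln n], [sqrt n], [ln N]. *)
Section Numeric.
Variables (R : realFieldType) (L v l r y : R).
Hypotheses (L_lb : 20 / 29 <= L) (L_ub : L <= 25 / 36).
Hypotheses (v_lb : 9 * 10 ^+ 2 <= v) (l_lb : 49 / 5 * L <= l) (r0 : 0 <= r)
  (rl_ub : (r + 1) * l <= 27 / 200 * v).
Hypotheses (y0 : 0 < y) (yE : y * y = v) (l_ub : l <= 2 * (5 * L + y / 32 - 1)).

(** Linear arithmetic treats products of variables as atoms; the bounds on them needed below are
    collected here. *)
Lemma numeric_bounds :
  [/\ 20 / 29 <= L, L <= 25 / 36, 9 * 10 ^+ 2 <= v, 49 / 5 * L <= l &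
  [/\ 0 <= r, 0 < y, y * y = v, 30 * y <= v &
  [/\ l <= 89 / 18 + y / 16, r * l + l <= 27 / 200 * v,
      r * (27 / 4) <= r * l, r * L <= r * (25 / 36) &
  [/\ y * l <= y * (89 / 18 + y / 16), y * L <= y * (25 / 36) &
      v * (20 / 29) <= v * L]]]].
Proof.
move: L_lb L_ub v_lb l_lb r0 rl_ub y0 yE l_ub => L1 L2 v1 l1 r1 rl y1 yv l2.
have y_lb : 30 <= y.
  rewrite leNgt; apply/negP => h.
  have : y * y < 30 * 30 by apply: ltr_pM; lra.
  lra.
have l3 : l <= 89 / 18 + y / 16 by lra.
split=> //; split=> //; first by rewrite -yv ler_pM2r.
split=> //; [lra | by apply: ler_wpM2l => //; lra | exact: ler_wpM2l |].
by split; [rewrite ler_pM2l | rewrite ler_pM2l | apply: ler_wpM2l; lra].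
Qed.

(** Used with [x = N / 3], [j = N - 2 n] if [N <= 3 n], and with [x = j = n] if [3 n < N <= 4 n].
    The main terms differ by at least [7 L v / 12], the worst case being [j = v]. *)
Lemma numeric_le4 (x s j lN : R) : 0 <= s <= 2 * y -> 0 <= j <= v ->
  3 * x <= 2 * v + j -> lN <= l + 2 * L ->
  2 * L * x + ((s + 5) / 3 + r) * lN < 2 * v * L + j * (7 / 12 * L) - L - l.
Proof.
have [L1 L2 v1 l1 [r1 y1 yv y2 [l2 rl rl' rL [yl yL vL]]]] := numeric_bounds.
move=> /andP[s0 sy] /andP[j0 jv] xj lN_ub.
have : ((s + 5) / 3 + r) * lN <= ((2 * y + 5) / 3 + r) * (l + 2 * L).
  apply: (@le_trans _ _ (((s + 5) / 3 + r) * (l + 2 * L))).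
    by apply: ler_wpM2l => //; lra.
  by apply: ler_wpM2r; lra.
have : 0 <= L * (2 * v + j - 3 * x) by apply: mulr_ge0; lra.
have : 0 <= L * (v - j) by apply: mulr_ge0; lra.
lra.
Qed.

Lemma numeric_le16 (s lN : R) : 0 <= s <= 4 * y -> lN <= l + 4 * L ->
  2 * L * v + ((s + 5) / 3 + r) * lN < 3 * v * L - L - l.
Proof.
have [L1 L2 v1 l1 [r1 y1 yv y2 [l2 rl rl' rL [yl yL vL]]]] := numeric_bounds.
move=> /andP[s0 sy] lN_ub.
have : ((s + 5) / 3 + r) * lN <= ((4 * y + 5) / 3 + r) * (l + 4 * L).
  apply: (@le_trans _ _ (((s + 5) / 3 + r) * (l + 4 * L))).
    by apply: ler_wpM2l => //; lra.
  by apply: ler_wpM2r; lra.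
lra.
Qed.

(* [z] stands for the fifth root of [v] *)
Lemma numeric_mid (s lN z : R) : 0 < z -> z ^+ 4 * z = v ->
  l / 5 <= z / 4 - 1 + 2 * L -> 0 <= s <= z ^+ 4 -> 5 * lN <= 8 * l ->
  2 * L * v + ((s + 5) / 3 + r) * lN < 4 * v * L.
Proof.
have [L1 L2 v1 l1 [r1 y1 yv y2 [l2 rl rl' rL [yl yL vL]]]] := numeric_bounds.
move=> z0 zE lz /andP[s0 sz] lN_ub.
have z4 : 0 < z ^+ 4 by rewrite exprn_gt0.
have : z ^+ 4 * (l / 5) <= z ^+ 4 * (z / 4 - 1 + 2 * (25 / 36)).
  by rewrite ler_pM2l //; lra.
(* [lz] and [l >= 49 L / 5] force [z >= 4 - 4 L / 25 > 31 / 8]. *)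
have : z ^+ 4 * (31 / 8) <= z ^+ 4 * z by rewrite ler_pM2l //; lra.
have : s * (l / 5) <= z ^+ 4 * (l / 5) by apply: ler_wpM2r; lra.
have : ((s + 5) / 3 + r) * lN <= ((s + 5) / 3 + r) * (8 * (l / 5)).
  by apply: ler_wpM2l; lra.
move: (z ^+ 4) zE z4 sz => z4; lra.
Qed.

(** The threshold [8 / 5] gives [lN - l > 3 lN / 8], and [3 / 8] exceeds the prime density [1 / 3]
    by [1 / 24]. *)
Lemma numeric_large (lN : R) : 8 * l < 5 * lN ->
  ((v + 5) / 3 + r) * lN < v * (lN - l).
Proof.
have [L1 L2 v1 l1 [r1 y1 yv y2 [l2 rl rl' rL [yl yL vL]]]] := numeric_bounds.
move=> h.
have : 0 <= v * (5 * lN - 8 * l) by apply: mulr_ge0; lra.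
have : 0 < (v / 24 - 5 / 3 - r) * lN by apply: mulr_gt0; lra.
lra.
Qed.
End Numeric.

(** * Consequences of the hypothesis on [E] *)

Lemma E_gt1_large (R : realType) (n : nat) : (1 < n)%N ->
  1 < E (n%:R : R) -> (900 <= n)%N.
Proof.
move=> n1; have n0 : (0 < n)%N by rewrite ltnW.
have v0 : 0 < n%:R :> R by rewrite ltr0n.
have l0 : 0 < ln n%:R :> R by rewrite ln_gt0 // ltr1n.
rewrite /E ln4 lnM ?posrE // mulrAC ltr_pdivlMr // mul1r => lE.
rewrite leqNgt; apply/negP => n_lt.
move: lE; apply/negP; rewrite -leNgt.
apply: small_E_le1 => //; [exact: ln2_lb|exact: ln2_ub| | |].
- by rewrite /constC; lra.
- by rewrite -natrX -natrM ler_nat ltnW.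
- by apply: ln_ub_of_small; rewrite n0 ltnW.
Qed.

(** Dropping the subtracted quotient and using [ln 4 - C < 27 / 200] settles [nstar]; monotonicity
    of [x / ln x] passes to [n]. *)
Lemma E_gt_ln (R : realType) (nstar n : nat) (c : R) : (1 < nstar)%N ->
  (nstar <= n)%N -> 1 <= c -> c < E (nstar%:R : R) ->
  (900 <= n)%N /\ c * ln n%:R <= 27 / 200 * n%:R.
Proof.
move=> n1 nn c1 cE.
have n_large := E_gt1_large n1 (le_lt_trans c1 cE).
split; first exact: leq_trans nn.
have v0 : 0 < nstar%:R :> R by rewrite ltr0n ltnW.
have vw : nstar%:R <= n%:R :> R by rewrite ler_nat.
have L1 := ln2_lb R; have L2 := ln2_ub R.
have l1 := ln_lb_of_large R n_large.
have C1 : 251 / 200 <= constC R by rewrite /constC; lra.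
move: cE; rewrite /E ln4 lnM ?posrE // mulrAC.
have := @ln_le_tangent R n%:R nstar%:R (lt_le_trans v0 vw) v0.
move: (nstar%:R : R) (n%:R : R) (ln nstar%:R) (ln n%:R) (ln 2) (constC R)
  v0 vw L1 L2 l1 C1 => v w l k L C v0 vw L1 L2 l1 C1 kl.
rewrite ltr_pdivlMr; last lra.
have : 0 <= L * (2 * L) / (L + l).
  by apply: divr_ge0; [apply: mulr_ge0|]; lra.
move: (_ / (L + l)) => q q0 cE.
have {}cE : c * l <= 27 / 200 * v.
  apply: (le_trans (ltW cE)); rewrite mulrC; apply: ler_wpM2r; lra.
(* The tangent bound reduces this to [(l - 1) (w - v) >= 0]. *)
have mono : k * v <= l * w.
  move: kl; rewrite -(ler_pM2r v0) mulrBl mulrDl divfK ?gt_eqF // => h.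
  have : 0 <= (l - 1) * (w - v) by apply: mulr_ge0; lra.
  lra.
have h1 : 0 <= c * (l * w - k * v) by apply: mulr_ge0; lra.
have h2 : 0 <= (27 / 200 * v - c * l) * w by apply: mulr_ge0; lra.
rewrite -(ler_pM2r v0); lra.
Qed.

(** * Logarithms of binomial coefficients *)

Lemma exists_sqrt N : exists s, (s ^ 2 <= N < s.+1 ^ 2)%N.
Proof.
elim: N => [|N [s /andP[h1 h2]]]; first by exists 0%N.
have [h|h] := leqP (s.+1 ^ 2) N.+1; last by exists s; rewrite (leqW h1) h.
exists s.+1; rewrite h; nia.
Qed.

Lemma ln_bin_le (R : realType) m n s x r :
  (n <= m)%N -> (0 < n)%N -> (nb_primes_gt n (prodP m n) <= r)%N ->
  (forall p, prime p -> (p %| 'C(m + n, n))%N -> (s < p)%N -> (p <= n)%N ->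
     (p <= x)%N && (m + n < p ^ 2)%N) ->
  ln ('C(m + n, n))%:R <=
    2 * ln 2 * x%:R + ((s%:R + 5) / 3 + r%:R) * ln (m + n)%:R :> R.
Proof.
move=> nm n0 nb H; have := bin_upper nm n0 H.
have N0 : (0 < m + n)%N by rewrite addn_gt0 n0 orbT.
move=> h; have {h} : ('C(m + n, n) <= 4 ^ x * (m + n) ^ (prime_pi s + r))%N.
  apply: (leq_trans h); apply: leq_mul; first exact: primorial_le.
  by rewrite leq_pexp2l // leq_add2l.
have C0 : (0 < 'C(m + n, n))%N by rewrite bin_gt0 leq_addl.
move/(ler_ln_nat R C0)/le_trans; apply.
rewrite ln_natM ?expn_gt0 ?N0 // !ln_natX //.
rewrite ln4 mulrC lerD2l.
apply: ler_wpM2r; first by rewrite ln_ge0 // ler1n.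
rewrite natrD lerD2r ler_pdivlMr // mulrC -natrM -[5]/(5%:R) -natrD ler_nat.
exact: prime_pi_bound.
Qed.

(** The central bound times [(3 / 2) ^ j], with [ln (3 / 2) >= 7 / 12 * ln 2]. *)
Lemma ln_bin_ge_step (R : realType) n j : (0 < n)%N -> (j <= n)%N ->
  2 * n%:R * ln 2 + j%:R * (7 / 12 * ln 2) - ln 2 - ln n%:R <=
    ln ('C(2 * n + j, n))%:R :> R.
Proof.
move=> n0 jn; have C0 : (0 < 'C(2 * n + j, n))%N by rewrite bin_gt0; lia.
have : (3 ^ j * 4 ^ n <= 2 ^ j * (2 * n * 'C(2 * n + j, n)))%N.
  have h1 := central_bin_ge n0; rewrite addnn -mul2n in h1.
  have h2 := @bin_step_ge 2 n j isT ltac:(lia).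
  apply: (leq_trans (leq_mul (leqnn _) h1)).
  by rewrite mulnCA [leqRHS]mulnCA leq_mul2l h2 orbT.
have pos : (0 < 3 ^ j * 4 ^ n)%N by rewrite muln_gt0 !expn_gt0.
move/(ler_ln_nat R pos).
rewrite !ln_natM ?muln_gt0 ?expn_gt0 ?n0 // !ln_natX // ln4.
have := ler_wpM2l (ler0n R j) (ln3_lb R); lra.
Qed.

(** Climbing from [2 n] to [3 n] to [4 n] gains [(3 / 2) ^ n (4 / 3) ^ n = 2 ^ n] over the central
    [4 ^ n]. *)
Lemma ln_bin_ge_four (R : realType) n : (0 < n)%N ->
  3 * n%:R * ln 2 - ln 2 - ln n%:R <= ln ('C(4 * n, n))%:R :> R.
Proof.
move=> n0; have C0 : (0 < 'C(4 * n, n))%N by rewrite bin_gt0; lia.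
have : (8 ^ n <= 2 * n * 'C(4 * n, n))%N.
  have h1 := central_bin_ge n0; rewrite addnn -mul2n in h1.
  have h2 := @bin_step_ge 2 n n isT ltac:(lia).
  have h3 := @bin_step_ge 3 n n isT ltac:(lia).
  rewrite -mulSnr in h2; rewrite -mulSnr in h3.
  have e4 : (4 ^ n = 2 ^ n * 2 ^ n)%N by rewrite -expnMn.
  have e8 : (8 ^ n = 2 ^ n * 4 ^ n)%N by rewrite -expnMn.
  have p2 : (0 < 2 ^ n)%N by rewrite expn_gt0.
  have p3 : (0 < 3 ^ n)%N by rewrite expn_gt0.
  have {h1}h2 : (3 ^ n * 2 ^ n <= 2 * n * 'C(3 * n, n))%N.
    rewrite -(leq_pmul2l p2) mulnCA -e4 [leqRHS]mulnCA.
    apply: (leq_trans (leq_mul (leqnn _) h1)).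
    by rewrite mulnCA leq_mul2l h2 orbT.
  rewrite -(leq_pmul2l p3) e8 mulnA [leqRHS]mulnCA.
  apply: (leq_trans (leq_mul h2 (leqnn _))).
  by rewrite -!mulnA !leq_mul2l [X in (X <= _)%N]mulnC h3 !orbT.
have pos : (0 < 8 ^ n)%N by rewrite expn_gt0.
move/(ler_ln_nat R pos).
rewrite !ln_natM ?muln_gt0 ?n0 // ln_natX //.
have -> : ln 8 = 3 * ln 2 :> R by exact: (@ln_natX R 2 3 isT).
lra.
Qed.

(** * Contradiction in each range of [m + n] relative to [n] *)

Theorem theorem1 (R : realType) (nstar r : nat)
  (hnstar : (1 < nstar)%N) (hE : r%:R + 1 < E (nstar%:R : R)) :
  forall m n : nat, (n <= m)%N -> (nstar <= n)%N ->
    (r < nb_primes_gt n (prodP m n))%N.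
Proof.
move=> m n nm nn; rewrite ltnNge; apply/negP => nb.
have [|n_large rl] := E_gt_ln hnstar nn _ hE; first by rewrite lerDr.
have n0 : (0 < n)%N by apply: leq_trans n_large.
have v_lb : 9 * 10 ^+ 2 <= n%:R :> R by rewrite -natrX -natrM ler_nat.
have v0 : 0 < n%:R :> R by rewrite ltr0n.
have L1 := ln2_lb R; have L2 := ln2_ub R.
have l_lb := ln_lb_of_large R n_large.
pose y := Num.sqrt (n%:R : R).
have y0 : 0 < y by rewrite sqrtr_gt0.
have yE : y * y = n%:R by rewrite -expr2 sqr_sqrtr ?ltW.
(* The tangent to the logarithm at 32 is taken at [y], whose least value is 30. *)
have l_ub : ln n%:R <= 2 * (5 * ln 2 + y / 32 - 1).
  have := @ln_le_tangent R y 32 y0 ltac:(lra).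
  have -> : ln 32 = 5 * ln 2 :> R by exact: (@ln_natX R 2 5 isT).
  by rewrite -yE lnM ?posrE //; lra.
have [s /andP[sN Ns]] := exists_sqrt (m + n).
have s_y (k : nat) : (m + n <= k ^ 2 * n)%N -> 0 <= (s%:R : R) <= k%:R * y.
  move=> kN; rewrite ler0n /= -(@ler_pXn2r _ 2) ?nnegrE ?mulr_ge0 ?(ltW y0) //.
  rewrite exprMn [y ^+ 2]expr2 yE -!natrX -natrM ler_nat.
  exact: leq_trans kN.
have ln_N k : (m + n <= 2 ^ k * n)%N ->
    ln (m + n)%:R <= ln n%:R + k%:R * ln 2 :> R.
  move=> kN; rewrite addrC -ln_natX // -ln_natM ?expn_gt0 //.
  by apply: ler_ln_nat; rewrite // addn_gt0 n0 orbT.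
have p_sq p : (s < p)%N -> (m + n < p ^ 2)%N.
  by move=> sp; apply: (leq_trans Ns); rewrite leq_exp2r.
have ub := @ln_bin_le R m n s n r nm n0 nb
  (fun p _ _ sp pn => introT andP (conj pn (p_sq p sp))).
(* Primes above [s] are thereby odd, as [prime_third_ndvd_bin] demands. *)
have s_gt1 : (1 < s)%N.
  rewrite -ltnS -ltn_sqr; apply: leq_ltn_trans Ns.
  by apply: leq_trans (leq_addl m n); apply: leq_trans n_large.
have [N3|N3] := leqP (m + n) (3 * n).
  have {}ub : ln ('C(m + n, n))%:R <= 2 * ln 2 * ((m + n) %/ 3)%:R
      + ((s%:R + 5) / 3 + r%:R) * ln (m + n)%:R :> R.
    apply: ln_bin_le => // p pp pC sp pn; rewrite p_sq // andbT leqNgt.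
    apply/negP; rewrite ltn_divLR // mulnC => N3p; move: pC; apply/negP.
    apply: prime_third_ndvd_bin => //; exact: leq_ltn_trans sp.
  have mn : (m - n <= n)%N by clear -N3; lia.
  have lb := @ln_bin_ge_step R n (m - n) n0 mn.
  have NE : (2 * n + (m - n) = m + n)%N by clear -nm; lia.
  rewrite NE in lb.
  have := le_trans lb ub; apply/negP; rewrite -ltNge.
  apply: (numeric_le4 L1 L2 v_lb l_lb (ler0n _ _) rl y0 yE l_ub).
  - by apply: s_y; clear -N3; lia.
  - by rewrite ler0n ler_nat.
  - by rewrite -!natrM -natrD ler_nat NE mulnC leq_divM.
  - by apply: (ln_N 2); clear -N3; lia.
have [N4|N4] := leqP (m + n) (4 * n).
  have lb := @ln_bin_ge_step R n n n0 (leqnn _).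
  have mono : ln ('C(2 * n + n, n))%:R <= ln ('C(m + n, n))%:R :> R.
    apply: ler_ln_nat; first by rewrite bin_gt0; clear; lia.
    by apply: leq_bin2l; clear -N3; lia.
  have := le_trans (le_trans lb mono) ub; apply/negP; rewrite -ltNge.
  apply: (numeric_le4 L1 L2 v_lb l_lb (ler0n _ _) rl y0 yE l_ub).
  - by apply: s_y; clear -N4; lia.
  - by rewrite ler0n lexx.
  - lra.
  - by apply: (ln_N 2); clear -N4; lia.
have [N16|N16] := leqP (m + n) (16 * n).
  have lb := @ln_bin_ge_four R n n0.
  have mono : ln ('C(4 * n, n))%:R <= ln ('C(m + n, n))%:R :> R.
    apply: ler_ln_nat; first by rewrite bin_gt0; clear; lia.
    by apply: leq_bin2l; exact: ltnW.
  have := le_trans (le_trans lb mono) ub; apply/negP; rewrite -ltNge.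
  apply: (numeric_le16 L1 L2 v_lb l_lb (ler0n _ _) rl y0 yE l_ub).
  - by apply: s_y; clear -N16; lia.
  - by apply: (ln_N 4); clear -N16; lia.
have N0 : (0 < m + n)%N by rewrite addn_gt0 n0 orbT.
have C0 : (0 < 'C(m + n, n))%N by rewrite bin_gt0 leq_addl.
have lb : n%:R * ln (m + n)%:R <= n%:R * ln n%:R + ln ('C(m + n, n))%:R :> R.
  rewrite -!ln_natX // -ln_natM ?expn_gt0 ?n0 //.
  apply: ler_ln_nat; first by rewrite expn_gt0 N0.
  exact: expn_le_binM.
have [lN|lN] := leP (5 * ln (m + n)%:R) (8 * ln n%:R : R).
  have N16l : n%:R * (4 * ln 2 + ln n%:R) <= n%:R * ln (m + n)%:R :> R.
    rewrite ler_pM2l // -(@ln_natX R 2 4) // -ln_natM //.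
    by apply: ler_ln_nat; [rewrite muln_gt0 | exact: ltnW].
  have s0 : (0 < s)%N by apply: ltnW.
  have ls : ln s%:R * 2 <= ln (m + n)%:R :> R.
    by rewrite mulrC -ln_natX //; apply: ler_ln_nat; rewrite // expn_gt0 s0.
  have : 4 * n%:R * ln 2 <= ln ('C(m + n, n))%:R :> R by lra.
  move/le_trans => /(_ _ ub); apply/negP; rewrite -ltNge.
  (* [z] is the fifth root of [n]; here [N ^ 5 <= n ^ 8], so [s <= sqrt N <= z ^ 4]. *)
  pose z := sequences.expR (ln n%:R / 5 : R).
  have lnE : sequences.expR (ln n%:R) = n%:R :> R by rewrite lnK.
  apply: (numeric_mid L1 L2 v_lb l_lb (ler0n _ _) rl y0 yE l_ub (z := z)) => //.
  - exact: expR_gt0.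
  - have -> : z ^+ 4 * z = z ^+ 5 by rewrite -exprSr.
    rewrite /z -expRM_natl (_ : 5 * (_ / 5) = ln n%:R) //.
    by rewrite mulrC divfK // pnatr_eq0.
  - have := @ln_le_tangent R z 4 (expR_gt0 _) ltac:(lra).
    by rewrite expRK ln4; lra.
  - rewrite ler0n /= /z -expRM_natl -[s%:R]lnK ?posrE ?ltr0n // ler_expR; lra.
(* With [s = n] no primes remain between [s] and [n], so [x = 0] is allowed. *)
have {}ub := @ln_bin_le R m n n 0%N r nm n0 nb
  ltac:(by move=> p _ _ np pn; rewrite ltnNge pn in np).
have := numeric_large L1 L2 v_lb l_lb (ler0n _ _) rl y0 yE l_ub lN.
by apply/negP; rewrite -leNgt; lra.
Qed.
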